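(* Let $q$ be a prime power, $r\ge2$ an integer, and $e=(q^r-1)/(q-1)$. Further let $$H_{\mathcal{N}}(X,Y)=X^{q^{r-1}}+\cdots+X^q+X-Y^e\in\mathbb{F}_{q^r}[X,Y],$$ and let $\mathcal{P}_{\mathcal{N}}=\{(\alpha,\beta)\in\mathbb{F}_{q^r}^2\mid H_{\mathcal{N}}(\alpha,\beta)=0\}$ be the set of rational points on $H_{\mathcal{N}}$. Let $\mathcal{C}_{H_{\mathcal{N}}}(\mathcal{P}_{\mathcal{N}},m)$ be the corresponding $C_{ab}$ code for some $m<n=|\mathcal{P}_{\mathcal{N}}|=q^{2r-1}$. Then encoding with the algorithm $\mathsf{BivariateMPE}$ described in the context uses $$O\big(\mathsf{M}(m+n)\log(m+n)\big)\subset\tilde{O}(n)$$ operations in $\mathbb{F}_{q^r}$. Unencoding with the algorithm $\mathsf{SemiGridUnencode}$ described in the context uses $$O\big(q^{r-1}\,\mathsf{M}(q^r)\log(q^r)\big)\subset\tilde{O}(n)$$ operations in $\mathbb{F}_{q^r}$.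
   Context: Codes. Write $\mathbb{F}=\mathbb{F}_{q^r}$ for the field with $q^r$ elements, and $a=\deg_Y H_{\mathcal{N}}=e$, $b=\deg_X H_{\mathcal{N}}=q^{r-1}$. The function field $\mathbb{F}(x,y)$ with $H_{\mathcal{N}}(x,y)=0$ has a rational place $P_\infty$ that is the only pole of $x$ and of $y$; $x^iy^j$ has pole order $ai+bj$ there. The other rational places are identified with the points of $\mathcal{P}_{\mathcal{N}}$. Each $f\in\mathbb{F}[x,y]$ has a unique expression with $y$-degree at most $a-1$, its standard form, by which it is lifted to $\mathbb{F}[X,Y]$. For an integer $m\ge0$ the Riemann–Roch space $\mathcal{L}(mP_\infty)$ has basis $B=\{x^iy^j\mid ai+bj\le m,\ j\le a-1\}$. With $\mathcal{P}_{\mathcal{N}}=\{P_1,\dots,P_n\}$, the code is $\mathcal{C}_{H_{\mathcal{N}}}(\mathcal{P}_{\mathcal{N}},m)=\{(f(P_1),\dots,f(P_n))\mid f\in\mathcal{L}(mP_\infty)\}$. For $m<n$ evaluation is injective on $\mathcal{L}(mP_\infty)$, and messages are the coefficient vectors on $B$ in some specified order. Encoding a message with corresponding polynomial $f$ in standard form means computing $(f(P_1),\dots,f(P_n))$, which is done by applying $\mathsf{BivariateMPE}$ to $f$ and $\mathcal{P}_{\mathcal{N}}$; unencoding is the inverse: given a codeword $(c_1,\dots,c_n)$, find $f\in\mathcal{L}(mP_\infty)$ in standard form with $f(P_i)=c_i$ for all $i$. Point sets and tables. For $\mathcal{P}\subseteq\mathbb{F}^2$, $\mathcal{X}(\mathcal{P})$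 is the set of $X$-coordinates of points of $\mathcal{P}$ and $\mathcal{Y}_\alpha(\mathcal{P})=\{\beta\mid(\alpha,\beta)\in\mathcal{P}\}$. For finite $\mathcal{A}$, $T\in\mathcal{B}^{\mathcal{A}}$ is a lookup table with stored values $T[a]$. A balanced partition tree of $\mathcal{S}\subseteq\mathbb{F}$ is a binary tree whose nodes are subsets of $\mathcal{S}$, with root $\mathcal{S}$, whose leaves are singletons, and in which each internal node is the disjoint union of its two children, whose cardinalities differ by at most $1$; $\mathcal{T}[\mathcal{N}]$ denotes the set of the two children of $\mathcal{N}$ in $\mathcal{T}$. Classical univariate subroutines: - $\mathsf{UnivariateMPE}(h,\mathcal{S})$ outputs $(h(\alpha))_{\alpha\in\mathcal{S}}$ in $O(\mathsf{M}(\deg h+|\mathcal{S}|)\log(\deg h+|\mathcal{S}|))$ operations. - $\mathsf{UnivariateInterp}_Y(\mathcal{S},\mathcal{F})$, for $\mathcal{F}\in\mathbb{F}^{\mathcal{S}}$, outputs the unique $f\in\mathbb{F}[Y]$ with $\deg f<|\mathcal{S}|$ and $f(\alpha)=\mathcal{F}[\alpha]$ for all $\alpha\in\mathcal{S}$, in $O(\mathsf{M}(|\mathcal{S}|)\log|\mathcal{S}|)$ operations. - $\mathsf{TreeVanish}_X(\mathcal{T})$, for a balanced partition tree $\mathcal{T}$ of $\mathcal{S}$, outputs $\big(\prod_{\alpha\in\mathcal{N}}(X-\alpha)\big)_{\mathcal{N}\in\mathcal{T}}$ in $O(\mathsf{M}(|\mathcal{S}|)\log|\mathcal{S}|)$ operations.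 Algorithm $\mathsf{BivariateMPE}(f,\mathcal{P})$, for $f=\sum_{i=0}^{d_Y}f_i(X)Y^i\in\mathbb{F}[X,Y]$: compute $\mathcal{X}=\mathcal{X}(\mathcal{P})$ and $\mathcal{Y}_\alpha=\mathcal{Y}_\alpha(\mathcal{P})$; for $i=0,\dots,d_Y$ compute $\mathcal{F}_i=\mathsf{UnivariateMPE}(f_i,\mathcal{X})$; for each $\alpha\in\mathcal{X}$ form $g_\alpha=\sum_{i=0}^{d_Y}\mathcal{F}_i[\alpha]Y^i$ and compute $\mathcal{G}_\alpha=\mathsf{UnivariateMPE}(g_\alpha,\mathcal{Y}_\alpha)$; return $(\mathcal{G}_\alpha[\beta])_{(\alpha,\beta)\in\mathcal{P}}$. Subroutine $\mathsf{Combine}(\mathcal{S},\mathcal{V},\mathcal{T},\mathcal{U})$, with $\mathcal{V}\in\mathbb{F}[Y]^{\mathcal{S}}$, $\mathcal{S}\ne\emptyset$ a node of the balanced partition tree $\mathcal{T}$, $\mathcal{U}=\mathsf{TreeVanish}_X(\mathcal{T})$: if $\mathcal{S}=\{\alpha\}$ return $\mathcal{V}[\alpha]$; otherwise let $\{\mathcal{S}_1,\mathcal{S}_2\}=\mathcal{T}[\mathcal{S}]$, compute recursively $\hat f_k=\mathsf{Combine}(\mathcal{S}_k,(\mathcal{V}[\alpha])_{\alpha\in\mathcal{S}_k},\mathcal{T},\mathcal{U})$ for $k=1,2$, and return $\hat f_1\,\mathcal{U}[\mathcal{S}_2]+\hat f_2\,\mathcal{U}[\mathcal{S}_1]$. Subroutine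 $\mathsf{BivariateInterp}(\mathcal{P},\mathcal{F})$, for $\mathcal{F}\in\mathbb{F}^{\mathcal{P}}$: let $\mathcal{X}=\mathcal{X}(\mathcal{P})$; for each $\alpha\in\mathcal{X}$ compute $\hat f_\alpha=\mathsf{UnivariateInterp}_Y\big(\mathcal{Y}_\alpha(\mathcal{P}),(\mathcal{F}[\alpha,\beta])_{\beta\in\mathcal{Y}_\alpha(\mathcal{P})}\big)$; let $\mathcal{T}$ be a balanced partition tree of $\mathcal{X}$ and $\mathcal{U}=\mathsf{TreeVanish}_X(\mathcal{T})$; let $h$ be the formal derivative of $\mathcal{U}[\mathcal{X}]$ and $\mathcal{R}=\mathsf{UnivariateMPE}(h,\mathcal{X})$; return $\mathsf{Combine}\big(\mathcal{X},(\hat f_\alpha/\mathcal{R}[\alpha])_{\alpha\in\mathcal{X}},\mathcal{T},\mathcal{U}\big)$. Algorithm $\mathsf{SemiGridUnencode}$. Input: the code with $\mathcal{P}=\{P_1,\dots,P_n\}$ and a codeword $(c_1,\dots,c_n)$. Put $\mathcal{F}[P_i]=c_i$, compute $\hat f=\mathsf{BivariateInterp}(\mathcal{P},\mathcal{F})\in\mathbb{F}[X,Y]$, and return $\hat f(x,y)$. Complexity counts basic arithmetic operations in the field on an algebraic RAM model (table retrieval and insertion cost $O(1)$). $\mathsf{M}(n)$ is the cost of multiplying two univariate polynomials over the field of degree at most $n$; one can take $\mathsf{M}(n)\in O(n\log n\log\log n)\subset\tilde{O}(n)$. Here $\tilde{O}(h)=\bigcup_{c\ge0}O(h\log^c h)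$.
   Formalization: The formal statement adds the customary convention that M(n)/n is positive and nondecreasing for n ≥ 1; without such regularity of M, sums of smaller multiplication costs need not be O(M(m+n) log(m+n)) and the encoding bound can fail. *)

(* Defs.v *)
From mathcomp Require Import all_boot all_order all_algebra.

Set Implicit Arguments.
Unset Strict Implicit.
Unset Printing Implicit Defensive.

Import GRing.Theory.

(* O and soft-O over an index set I of problem instances: the constants are
   uniform over all instances, i.e. over all q, r, m and all inputs. *)

(* log_2 rounded up and bounded below by 1, so that a bound such as
   M(s) log(s) does not vanish on inputs of size s = 1. *)
Definition lg (n : nat) : nat := maxn 1 (up_log 2 n).

Definition bigO (I : Type) (g f : I -> nat) : Prop :=
  exists C : nat, forall i, f i <= C * g i.

Definition softO (I : Type) (h f : I -> nat) : Prop :=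
  exists c : nat, bigO (fun i => h i * lg (h i) ^ c) f.

(* M(n) bounds the cost of a product of two polynomials of degree at most n.
   Besides M(n) in O(n log n log log n), this records the customary convention
   that M(n) / n is positive and nondecreasing for n >= 1. *)
Record multiplication_time (M : nat -> nat) : Prop := MultiplicationTime {
  mult_quasilinear :
    exists C : nat, forall n, 0 < n -> M n <= C * (n * lg n * lg (lg n));
  mult_pos : 0 < M 1;
  mult_superlinear : forall k l, 0 < k -> k <= l -> M k * l <= M l * k
}.

(* A computation is its result together with the number of operations it uses;
   field operations, table retrievals and table insertions cost 1 each. *)
Definition ram (A : Type) : Type := (A * nat)%type.
Definition result (A : Type) (c : ram A) : A := c.1.
Definition cost (A : Type) (c : ram A) : nat := c.2.

Definition ret (A : Type) (a : A) : ram A := (a, 0).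
Definition bind (A B : Type) (c : ram A) (k : A -> ram B) : ram B :=
  (result (k (result c)), cost c + cost (k (result c))).

Notation "'run' x ':=' c 'in' k" := (bind c (fun x => k))
  (at level 200, x name, c at level 100, k at level 200, right associativity,
   format "'[v' 'run'  x  ':='  c  'in' '/' k ']'").

Fixpoint mapM (A B : Type) (f : A -> ram B) (s : seq A) : ram (seq B) :=
  if s is a :: s' then
    run b := f a in
    run bs := mapM f s' in
    ret (b :: bs)
  else ret [::].

(* Tables return a default value outside the set of stored keys. *)
Definition table (K B : Type) : Type := K -> B.

Definition get (K B : Type) (T : table K B) (k : K) : ram B := (T k, 1).

Definition put (K : eqType) (B : Type) (T : table K B) (k : K) (b : B) :
    ram (table K B) :=
  ((fun k' => if k' == k then b else T k'), 1).

Fixpoint tabulate (K : eqType) (B : Type) (b0 : B) (f : K -> ram B)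
    (s : seq K) : ram (table K B) :=
  if s is k :: s' then
    run T := tabulate b0 f s' in
    run b := f k in
    put T k b
  else ret (fun=> b0).

Section Algorithms.

Variable F : finFieldType.
Local Open Scope ring_scope.

(* Bivariate polynomials in F[X, Y] are elements of F[X][Y]: the outer variable
   is Y, and f`_j : {poly F} is the coefficient of Y^j. *)
Definition bipoly : Type := {poly {poly F}}.

Definition eval2 (f : bipoly) (P : F * F) : F := f.[P.2%:P].[P.1].

Definition Xset (P : seq (F * F)) : {set F} := [set a | a \in map fst P].
Definition Yset (P : seq (F * F)) (a : F) : {set F} := [set b | (a, b) \in P].

(* The node sets are those of leaves below a node. *)
Inductive ptree : Type := Leaf of F | Node of ptree & ptree.

Fixpoint root_set (T : ptree) : {set F} :=
  match T with
  | Leaf a => [set a]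
  | Node l r => root_set l :|: root_set r
  end.

Fixpoint nodes (T : ptree) : seq {set F} :=
  match T with
  | Leaf _ => [:: root_set T]
  | Node l r => root_set T :: nodes l ++ nodes r
  end.

Fixpoint balanced (T : ptree) : bool :=
  match T with
  | Leaf _ => true
  | Node l r =>
      [&& [disjoint root_set l & root_set r],
          (#|root_set l| <= #|root_set r|.+1)%N,
          (#|root_set r| <= #|root_set l|.+1)%N,
          balanced l & balanced r]
  end.

Definition balanced_partition_tree (S : {set F}) (T : ptree) : Prop :=
  root_set T = S /\ balanced T.

Definition vanishing (S : {set F}) : {poly F} := \prod_(a in S) ('X - a%:P).

Definition fdiv (a b : F) : ram F := (a / b, 1%N).

Definition poly_add (p q : {poly F}) : ram {poly F} :=
  (p + q, maxn (size p) (size q)).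

(* Per coefficient: one addition to get i%:R and one product i%:R * p`_i. *)
Definition poly_deriv (p : {poly F}) : ram {poly F} :=
  (p^`(), (2 * size p)%N).

Definition poly_div_scalar (p : {poly F}) (c : F) : ram {poly F} :=
  run s := mapM (fun b => fdiv b c) p in ret (Poly s).

(* One table insertion per point for each of the two. *)
Definition compute_X (P : seq (F * F)) : ram {set F} := (Xset P, size P).
Definition compute_Y (P : seq (F * F)) : ram (table F {set F}) :=
  (Yset P, size P).

Record subroutines : Type := Subroutines {
  PolyMul : {poly F} -> {poly F} -> ram {poly F};
  UnivariateMPE : {poly F} -> {set F} -> ram (table F F);
  UnivariateInterp : {set F} -> table F F -> ram {poly F};
  TreeVanish : ptree -> ram (table {set F} {poly F});
  PartitionTree : {set F} -> ptree
}.

(* Here (size p).-1 is the degree of p, with deg 0 = 0. *)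
Record implements (M : nat -> nat) (C : nat) (A : subroutines) : Prop :=
  Implements {
  PolyMul_result : forall p q, result (PolyMul A p q) = p * q;
  PolyMul_cost : forall (n : nat) (p q : {poly F}),
    ((size p).-1 <= n)%N -> ((size q).-1 <= n)%N ->
    (cost (PolyMul A p q) <= M n)%N;
  UnivariateMPE_result : forall (h : {poly F}) (S : {set F}) a,
    a \in S -> result (UnivariateMPE A h S) a = h.[a];
  UnivariateMPE_cost : forall (h : {poly F}) (S : {set F}),
    let s := ((size h).-1 + #|S|)%N in
    (cost (UnivariateMPE A h S) <= C * (M s * lg s))%N;
  UnivariateInterp_size : forall (S : {set F}) V,
    (size (result (UnivariateInterp A S V)) <= #|S|)%N;
  UnivariateInterp_result : forall (S : {set F}) V a,
    a \in S -> (result (UnivariateInterp A S V)).[a] = V a;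
  UnivariateInterp_cost : forall (S : {set F}) V,
    (cost (UnivariateInterp A S V) <= C * (M #|S| * lg #|S|))%N;
  TreeVanish_result : forall S T N,
    balanced_partition_tree S T -> N \in nodes T ->
    result (TreeVanish A T) N = vanishing N;
  TreeVanish_cost : forall S T,
    balanced_partition_tree S T ->
    (cost (TreeVanish A T) <= C * (M #|S| * lg #|S|))%N;
  PartitionTree_result : forall S : {set F},
    S != set0 -> balanced_partition_tree S (PartitionTree A S)
}.

Variable A : subroutines.

(* Writing down every node of the tree costs its cardinality. *)
Definition compute_tree (S : {set F}) : ram ptree :=
  let T := PartitionTree A S in (T, (\sum_(N <- nodes T) #|N|)%N).

Definition BivariateMPE (f : bipoly) (P : seq (F * F)) : ram (seq F) :=
  run X := compute_X P in
  run Y := compute_Y P in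
  let I := iota 0 (size f) in
  run Fs := tabulate (fun=> 0) (fun i => UnivariateMPE A f`_i X) I in
  run G := tabulate (fun=> 0)
    (fun a =>
       run g := mapM (fun i => run Fi := get Fs i in get Fi a) I in
       run Ya := get Y a in
       UnivariateMPE A (Poly g) Ya)
    (enum X) in
  mapM (fun ab => run Ga := get G ab.1 in get Ga ab.2) P.

(* f * u for u in F[X], coefficient by coefficient in Y. *)
Definition bipoly_mul (f : bipoly) (u : {poly F}) : ram bipoly :=
  run s := mapM (fun p => PolyMul A p u) f in ret (Poly s).

Definition bipoly_add (f g : bipoly) : ram bipoly :=
  run s := mapM (fun j => poly_add f`_j g`_j)
                (iota 0 (maxn (size f) (size g))) in
  ret (Poly s).

(* The node S of the whole tree is given as the subtree T rooted at S, and
   V[a] in F[Y] is embedded in F[X, Y]. *)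
Fixpoint Combine (T : ptree) (V : table F {poly F})
    (U : table {set F} {poly F}) : ram bipoly :=
  match T with
  | Leaf a => run v := get V a in ret (map_poly polyC v)
  | Node l r =>
      run Vl := tabulate 0 (get V) (enum (root_set l)) in
      run fl := Combine l Vl U in
      run Vr := tabulate 0 (get V) (enum (root_set r)) in
      run fr := Combine r Vr U in
      run ul := get U (root_set l) in
      run ur := get U (root_set r) in
      run gl := bipoly_mul fl ur in
      run gr := bipoly_mul fr ul in
      bipoly_add gl gr
  end.

Definition BivariateInterp (P : seq (F * F)) (V : table (F * F)%type F) :
    ram bipoly :=
  run X := compute_X P in
  run Y := compute_Y P in
  run fhat := tabulate 0
    (fun a =>
       run Ya := get Y a in
       run Va := tabulate 0 (fun b => get V (a, b)) (enum Ya) in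
       UnivariateInterp A Ya Va)
    (enum X) in
  run T := compute_tree X in
  run U := TreeVanish A T in
  run uX := get U X in
  run h := poly_deriv uX in
  run R := UnivariateMPE A h X in
  run W := tabulate 0
    (fun a =>
       run fa := get fhat a in
       run ra := get R a in
       poly_div_scalar fa ra)
    (enum X) in
  Combine T W U.

(* Input: the points P_1, ..., P_n and the word c_1, ..., c_n.  The returned
   f(x, y) is represented by the bivariate polynomial f. *)
Definition SemiGridUnencode (P : seq (F * F)) (c : seq F) : ram bipoly :=
  run V := tabulate 0 (fun ab => ret c`_(index ab P)) P in
  BivariateInterp P V.

End Algorithms.

Section NormTrace.

Variables (F : finFieldType) (q r : nat).
Local Open Scope ring_scope.

Definition nt_e : nat := ((q ^ r - 1) %/ (q - 1))%N.

Definition HN : bipoly F := (\sum_(i < r) 'X^(q ^ i))%:P - 'X^nt_e.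

Definition PN : {set F * F} := [set P | eval2 HN P == 0].

(* Exponents (i, j) of the basis x^i y^j of L(m Pinf), with a = e and
   b = q^(r-1). *)
Definition rr_basis (m : nat) : seq (nat * nat) :=
  [seq ij <- [seq (i, j) | i <- iota 0 m.+1, j <- iota 0 nt_e]
     | (nt_e * ij.1 + q ^ r.-1 * ij.2 <= m)%N].

(* The element of L(m Pinf), in standard form, with coefficients c on the
   basis; values of c outside of the basis are irrelevant. *)
Definition message_poly (m : nat) (c : nat * nat -> F) : bipoly F :=
  \sum_(ij <- rr_basis m) (c ij *: 'X^(ij.1))%:P * 'X^(ij.2).

Definition codeword (P : seq (F * F)) (m : nat) (w : seq F) : Prop :=
  exists c, w = [seq eval2 (message_poly m c) p | p <- P].

End NormTrace.

Definition prime_power (q : nat) : Prop :=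
  exists p k : nat, [/\ prime p, 0 < k & q = p ^ k].

(* The code C_{H_N}(P_N, m), including the order P_1, ..., P_n of its points. *)
Record nt_code : Type := NTCode {
  nt_q : nat;
  nt_r : nat;
  nt_field : finFieldType;
  nt_m : nat;
  nt_points : seq (nt_field * nt_field);
  nt_q_prime_power : prime_power nt_q;
  nt_r_ge2 : 2 <= nt_r;
  nt_card_field : #|nt_field| = nt_q ^ nt_r;
  nt_points_uniq : uniq nt_points;
  nt_points_curve : nt_points =i PN nt_field nt_q nt_r;
  nt_m_lt : nt_m < #|PN nt_field nt_q nt_r|
}.

Definition nt_n (N : nt_code) : nat := #|PN (nt_field N) (nt_q N) (nt_r N)|.

Record encoding : Type := Encoding {
  enc_code :> nt_code;
  enc_message : nat * nat -> nt_field enc_code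
}.

Record unencoding : Type := Unencoding {
  unenc_code :> nt_code;
  unenc_word : seq (nt_field unenc_code);
  unenc_codeword : codeword (nt_q unenc_code) (nt_r unenc_code)
                     (nt_points unenc_code) (nt_m unenc_code) unenc_word
}.

Definition encoding_cost (A : forall F : finFieldType, subroutines F)
    (E : encoding) : nat :=
  cost (BivariateMPE (A (nt_field E))
          (message_poly (nt_q E) (nt_r E) (nt_m E) (@enc_message E))
          (nt_points E)).

Definition unencoding_cost (A : forall F : finFieldType, subroutines F)
    (D : unencoding) : nat :=
  cost (SemiGridUnencode (A (nt_field D)) (nt_points D) (unenc_word D)).

(* Main.v *)
Require Import Defs.
From mathcomp Require Import all_boot all_order all_algebra all_field zify.

(** The curve has n = q^(2r-1) rational points because each point
(alpha, beta) satisfies Tr(alpha) = beta^e, and beta^e is a fixed point of the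
q-th power map.  A trace
fibre has at most q^(r-1) points, being the root set of a polynomial of that
degree; there are at most q fixed points, and the fibres above them cover a
field of q^r elements.  Hence every fibre above a fixed point has exactly
q^(r-1) points, and each of the q^r values of beta contributes one such fibre
([card_trace_fibre], [card_PN]).

Write Q = q^r and b = q^(r-1), so that n = bQ and e <= 2b.  Both running times
are sums of subproblem costs M(s) log(s).  As M(s)/s is nondecreasing,
subproblems of sizes at most l and of total size at most cl cost together at
most c M(l) log(l) ([sum_mult_lg]).

Encoding, with l = m + n: a polynomial in L(m Pinf) has at most e coefficients
in F[X], each of degree at most m/e, so the evaluations in X have total size at
most m + eQ; the evaluations in Y have total size at most eQ + n.  Both are
O(l), and so are the remaining table operations ([cost_BivariateMPE_le]).

Unencoding: the fibres have total size n = bQ, so with l = Q the interpolations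
in Y cost b M(Q) log(Q).  A balanced partition tree has logarithmic depth, so
its nodes have total size O(Q log Q) ([sum_card_nodes]).  Since the equation
beta^e = Tr(alpha) has at most e solutions beta, all polynomials met in the combination
have at most e coefficients in F[X]; a node of cardinality s therefore costs
O(e M(s)), and all nodes together cost O(b M(Q) log Q) ([Combine_le]).  The
evaluation of the derivative of the vanishing polynomial has size up to 2Q,
and M(2Q) need not be O(M(Q)); here the factor b, which is at least the square
root of Q, absorbs the logarithms of the quasilinear bound on M
([mult_lg_double]).

Finally M(l) log(l) = O(l log^3 l), which turns both bounds into soft-O of n. *)

Set Implicit Arguments.
Unset Strict Implicit.
Unset Printing Implicit Defensive.

Import GRing.Theory.

(** * Costs of loops *)

Lemma cost_bind (A B : Type) (c : ram A) (k : A -> ram B) :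
  cost (bind c k) = cost c + cost (k (result c)).
Proof. by []. Qed.

Lemma sum_nat_const_seq (I : Type) (s : seq I) c : \sum_(i <- s) c = size s * c.
Proof. by rewrite big_const_seq count_predT iter_addn_0 mulnC. Qed.

Lemma cost_mapM (A B : Type) (f : A -> ram B) (s : seq A) :
  cost (mapM f s) = \sum_(a <- s) cost (f a).
Proof.
elim: s => [|a s IHs]; first by rewrite big_nil.
by rewrite big_cons -IHs /= /bind /cost /= addn0.
Qed.

Lemma result_mapM (A B : Type) (f : A -> ram B) (s : seq A) :
  result (mapM f s) = [seq result (f a) | a <- s].
Proof. by elim: s => [//|a s IHs] /=; rewrite /bind /result /= -IHs. Qed.

Lemma cost_tabulate (K : eqType) (B : Type) (b0 : B) (f : K -> ram B) s :
  cost (tabulate b0 f s) = \sum_(k <- s) (cost (f k)).+1.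
Proof.
elim: s => [|k s IHs]; first by rewrite big_nil.
by rewrite big_cons -IHs /= /bind /cost /= addnC addn1.
Qed.

Lemma result_tabulate (K : eqType) (B : Type) (b0 : B) (f : K -> ram B) s k :
  result (tabulate b0 f s) k = if k \in s then result (f k) else b0.
Proof.
elim: s => [//|k' s IHs]; rewrite inE /bind /result /=.
by case: eqP => [->|_] //=; rewrite -IHs.
Qed.

(** * Logarithms *)

Lemma lg_gt0 n : 0 < lg n.
Proof. by rewrite leq_max. Qed.

Lemma leq_lg m n : m <= n -> lg m <= lg n.
Proof. by move=> le_mn; rewrite geq_max leq_maxl leq_max leq_up_log ?orbT. Qed.

Lemma lg_min n k : 0 < k -> n <= 2 ^ k -> lg n <= k.
Proof. by move=> k_gt0 le_n; rewrite geq_max k_gt0 up_log_min. Qed.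

Lemma leq_exp_lg n : n <= 2 ^ lg n.
Proof.
apply: leq_trans (up_logP n (isT : 1 < 2)) _.
by rewrite leq_exp2l // leq_max leqnn orbT.
Qed.

Lemma lg_double n : lg (2 * n) <= 2 * lg n.
Proof.
apply: lg_min; first by rewrite muln_gt0 lg_gt0.
apply: (leq_trans (leq_mul (leqnn 2) (leq_exp_lg n))).
by rewrite -expnS leq_exp2l //; have := lg_gt0 n; lia.
Qed.

Lemma lg_square n : lg (n * n) <= 2 * lg n.
Proof.
apply: lg_min; first by rewrite muln_gt0 lg_gt0.
by rewrite mul2n -addnn expnD leq_mul ?leq_exp_lg.
Qed.

Lemma lg_id n : 0 < n -> lg n <= n.
Proof. by move=> n_gt0; apply: lg_min n_gt0 (ltnW (ltn_expl _ _)). Qed.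

Lemma square_le_exp2 k : k ^ 2 <= 4 * 2 ^ k.-1.
Proof.
case: k => [|k] //=; elim: k => [//|k IHk]; rewrite [2 ^ _]expnS.
case: k IHk => [//|[//|k]] IHk.
by move: IHk; set E := 2 ^ _; rewrite -!mulnn; nia.
Qed.

(** A square root absorbs a logarithm; with [lg_square] this lets b >= sqrt(Q)
absorb log(Q)^2. *)
Lemma lg_exp2_le n : 0 < n -> lg n ^ 2 <= 4 * n.
Proof.
move=> n_gt0; apply: leq_trans (square_le_exp2 _) _; rewrite leq_pmul2l //.
rewrite /lg; have [n_gt1|] := ltnP 1 n; last first.
  by case: n n_gt0 => [|[|]] // _ _; rewrite up_log1.
have:= up_log_gtn (isT : 1 < 2) n_gt1.
have: 0 < up_log 2 n by rewrite up_log_gt0.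
by move=> /maxn_idPr ->; apply: ltnW.
Qed.

(** * Multiplication time *)

Section MultiplicationTime.

Variables (M : nat -> nat) (hM : multiplication_time M).

(** Linear overheads are dominated by the multiplication cost: the ratio M(n)/n
is at least M(1), which is positive. *)
Lemma mult_ge_id n : 0 < n -> n <= M n.
Proof.
move=> n_gt0; have := mult_superlinear hM (isT : 0 < 1) n_gt0.
by have := mult_pos hM; rewrite muln1; nia.
Qed.

Lemma leq_mult k l : 0 < k -> k <= l -> M k <= M l.
Proof.
move=> k_gt0 le_kl; have := mult_superlinear hM k_gt0 le_kl.
nia.
Qed.

Lemma leq_mult_lg k l : 0 < k -> k <= l -> M k * lg k <= M l * lg l.
Proof. by move=> k_gt0 le_kl; rewrite leq_mul ?leq_mult ?leq_lg. Qed.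

(** Monotonicity of M(s)/s: M(s) log(s) is at most the share s/l of
M(l) log(l), and the shares add up to c.  The value of M at 0 is unconstrained,
hence the positivity of the sizes. *)
Lemma sum_mult_lg (I : eqType) (s : seq I) (f : I -> nat) l c :
    0 < l -> (forall i, i \in s -> 0 < f i <= l) ->
    \sum_(i <- s) f i <= c * l ->
  \sum_(i <- s) M (f i) * lg (f i) <= c * (M l * lg l).
Proof.
move=> l_gt0 f_le sum_le; rewrite -(leq_pmul2r l_gt0) big_distrl /=.
have term i : i \in s -> M (f i) * lg (f i) * l <= M l * lg l * f i.
  move=> /f_le/andP[f_gt0 le_fl].
  by have := mult_superlinear hM f_gt0 le_fl; have := leq_lg le_fl; nia.
rewrite big_seq (leq_trans (leq_sum _ term)) // -big_seq -big_distrr /=.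
by have := leq_mul (leqnn (M l * lg l)) sum_le; lia.
Qed.

(** The crude bound log log n <= log n suffices for a soft-O statement. *)
Lemma mult_lg_quasilinear :
  exists C, forall n, 0 < n -> M n * lg n <= C * (n * lg n ^ 3).
Proof.
have [C MC] := mult_quasilinear hM; exists C => n n_gt0.
apply: leq_trans (leq_mul (MC n n_gt0) (leqnn _)) _.
have := leq_mul (leqnn (C * (n * lg n * lg n))) (lg_id (lg_gt0 n)).
by rewrite !expnS expn0 muln1; lia.
Qed.

(** M may jump by an unbounded factor between Q and 2Q, so the two sides are
compared through the quasilinear upper bound on M(2Q) and the lower bound
M(Q) >= Q; the surplus log(Q)^2 is paid for by b. *)
Lemma mult_lg_double :
  exists C, forall b Q, 0 < b -> 0 < Q -> Q <= b * b ->
    M (2 * Q) * lg (2 * Q) <= C * (b * (M Q * lg Q)).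
Proof.
have [C MC] := mult_lg_quasilinear; exists (256 * C) => b Q b_gt0 Q_gt0 leQ.
have Q2_gt0 : 0 < 2 * Q by rewrite muln_gt0.
apply: leq_trans (MC _ Q2_gt0) _.
have le1 := lg_double Q.
have le2 : lg Q <= 2 * lg b by apply: leq_trans (leq_lg leQ) (lg_square b).
have le3 := lg_exp2_le b_gt0; have le4 := mult_ge_id Q_gt0.
have le5 : lg (2 * Q) ^ 3 <= 8 * lg Q ^ 3 by rewrite -(expnMn 2 _ 3) leq_exp2r.
have le6 : lg Q ^ 2 <= 16 * b.
  apply: (@leq_trans ((2 * lg b) ^ 2)); first by rewrite leq_exp2r.
  by rewrite expnMn; lia.
have le7 : lg Q ^ 3 <= 16 * b * lg Q by rewrite expnSr leq_mul2r le6 orbT.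
have le8 : Q * (b * lg Q) <= M Q * (b * lg Q) by rewrite leq_mul2r le4 orbT.
have le9 : Q * lg (2 * Q) ^ 3 <= Q * (128 * b * lg Q).
  by rewrite leq_mul2l; apply/orP; right; lia.
have le10 : Q * lg (2 * Q) ^ 3 <= 128 * (M Q * (b * lg Q)) by lia.
have := leq_mul (leqnn (2 * C)) le10; lia.
Qed.

End MultiplicationTime.

(** * The rational points of the norm-trace curve *)

Section NormTraceExponents.

Variables q r : nat.
Hypotheses (q_pp : prime_power q) (r_gt1 : 1 < r).
Local Notation e := (nt_e q r).

Lemma prime_power_gt1 : 1 < q.
Proof.
have [p [k [p_pr k_gt0 ->]]] := q_pp.
by apply: leq_trans (prime_gt1 p_pr) _; rewrite -{1}(expn1 p) leq_exp2l ?prime_gt1.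
Qed.

Lemma nt_e_pred : e * (q - 1) = q ^ r - 1.
Proof.
have q_gt1 := prime_power_gt1.
have eqr : q ^ r - 1 = (\sum_(i < r) q ^ i) * (q - 1).
  by rewrite !subn1 predn_exp mulnC.
by rewrite /nt_e eqr mulnK // subn_gt0.
Qed.

Lemma nt_q_exp : q ^ r = q * q ^ (r - 1).
Proof. by rewrite -expnS subn1 prednK // ltnW. Qed.

Lemma nt_e_gt0 : 0 < e.
Proof.
have := nt_e_pred; have q_gt1 := prime_power_gt1.
have : 1 < q ^ r by rewrite -{1}(expn0 q) ltn_exp2l // ltnW.
by case: (e) => //; lia.
Qed.

Lemma nt_e_lt : e < q ^ r.
Proof. by have := nt_e_pred; have := nt_e_gt0; have := prime_power_gt1; nia. Qed.

Lemma nt_e_le : e <= 2 * q ^ (r - 1).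
Proof.
by have := nt_e_pred; have := nt_q_exp; have := nt_e_gt0; have := prime_power_gt1; nia.
Qed.

Lemma nt_root_exp_gt1 : 1 < q ^ (r - 1).
Proof. by rewrite -(expn0 q) ltn_exp2l ?prime_power_gt1 // subn_gt0. Qed.

Lemma nt_q_exp_le : q ^ r <= q ^ (r - 1) * q ^ (r - 1).
Proof. by rewrite -expnD leq_exp2l ?prime_power_gt1 //; lia. Qed.

End NormTraceExponents.

Section NormTrace.

Variables (F : finFieldType) (q r : nat).
Hypotheses (q_pp : prime_power q) (r_gt1 : 1 < r) (cardF : #|F| = q ^ r).
Local Notation e := (nt_e q r).

Local Open Scope ring_scope.

Definition trace_poly : {poly F} := \sum_(i < r) 'X^(q ^ i).

Lemma horner_trace (a : F) : trace_poly.[a] = \sum_(i < r) a ^+ (q ^ i).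
Proof.
rewrite horner_sum; apply: eq_bigr => i _.
by rewrite hornerXn.
Qed.

Lemma eval2_HN a b : eval2 (HN F q r) (a, b) = trace_poly.[a] - b ^+ e.
Proof. by rewrite /eval2 /HN !hornerE. Qed.

Lemma mem_PN a b : ((a, b) \in PN F q r) = (trace_poly.[a] == b ^+ e).
Proof. by rewrite inE eval2_HN subr_eq0. Qed.

Lemma expr_qD : {morph (fun x : F => x ^+ q) : x y / x + y}.
Proof.
have [p [k [p_pr k_gt0 def_q]]] := q_pp => x y.
have charF : p \in [pchar F].
  by apply: (@card_finPcharP _ p (k * r)); rewrite // cardF def_q expnM.
by apply: exprDn_pchar; rewrite def_q pnatX (pnatE _ p_pr) charF.
Qed.

(** Raising to the power q shifts the summands a^(q^i) by one, and the last one
becomes a^(q^r) = a. *)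
Lemma expr_q_trace (a : F) : trace_poly.[a] ^+ q = trace_poly.[a].
Proof.
rewrite horner_trace (big_morph _ expr_qD (expr0n _ _)).
have -> : (q == 0%N) = false by have := prime_power_gt1 q_pp; lia.
case: r r_gt1 cardF => // r' _ cardF'.
rewrite big_ord_recr [RHS]big_ord_recl /= -exprM -expnSr -cardF' expf_card.
rewrite expn0 expr1 addrC; congr (_ + _); apply: eq_bigr => i _.
by rewrite -exprM -expnSr.
Qed.

(** As e(q-1) = q^r - 1, the exponent e * q equals q^r + (e-1), and the q^r-th
power map is the identity. *)
Lemma expr_q_norm (b : F) : (b ^+ e) ^+ q = b ^+ e.
Proof.
have Q_gt0 : (0 < q ^ r)%N by rewrite expn_gt0 ltnW ?(prime_power_gt1 q_pp).
have -> : (b ^+ e) ^+ q = b ^+ (q ^ r + e.-1).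
  rewrite -exprM; congr (_ ^+ _).
  have := nt_e_pred r q_pp; have := nt_e_gt0 q_pp r_gt1; have := prime_power_gt1 q_pp.
  by move: Q_gt0; case: (nt_e q r) => // e'; nia.
by rewrite exprD -cardF expf_card -exprS prednK // (nt_e_gt0 q_pp r_gt1).
Qed.

Lemma card_le_roots (p : {poly F}) (S : {set F}) k :
  p != 0 -> (size p <= k.+1)%N -> {in S, forall a, root p a} -> (#|S| <= k)%N.
Proof.
move=> p_neq0 size_p S_root; rewrite cardE -ltnS; apply: leq_trans size_p.
apply: max_poly_roots (enum_uniq _) => //.
by apply/allP => a; rewrite mem_enum => /S_root.
Qed.

Definition trace_fibre (c : F) : {set F} := [set a | trace_poly.[a] == c].

Lemma card_trace_fibre_le c : (#|trace_fibre c| <= q ^ (r - 1))%N.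
Proof.
have q_gt1 := prime_power_gt1 q_pp; have b_gt1 := nt_root_exp_gt1 q_pp r_gt1.
apply: (@card_le_roots (trace_poly - c%:P)).
- apply/eqP => /(congr1 (fun p : {poly F} => p`_(q ^ (r - 1)))).
  rewrite coefB coefC coef_sum coef0 gtn_eqF ?subr0; last exact: ltnW.
  have lt_r : (r - 1 < r)%N by lia.
  rewrite (bigD1 (Ordinal lt_r)) //= coefXn eqxx big1 ?addr0 => [|i ne_i].
    by move/eqP; rewrite oner_eq0.
  by rewrite coefXn eqn_exp2l // eq_sym -val_eqE in ne_i *; rewrite (negPf ne_i).
- rewrite (leq_trans (size_polyD _ _)) // geq_max size_polyN.
  rewrite (leq_trans (size_polyC_leq1 _)) // andbT.
  apply: (leq_trans (size_sum _ _ _)); apply/bigmax_leqP => i _.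
  by rewrite size_polyXn ltnS leq_exp2l //; have := ltn_ord i; lia.
by move=> a; rewrite inE rootE !hornerE subr_eq0.
Qed.

Definition q_fixed : {set F} := [set c | c ^+ q == c].

Lemma card_q_fixed_le : (#|q_fixed| <= q)%N.
Proof.
have q_gt1 := prime_power_gt1 q_pp.
have size_q : size ('X^q - 'X : {poly F}) = q.+1.
  by rewrite size_polyDl ?size_polyN ?size_polyXn ?size_polyX.
apply: (@card_le_roots ('X^q - 'X)); rewrite -?size_poly_eq0 ?size_q //.
by move=> c; rewrite inE rootE !hornerE subr_eq0.
Qed.

(** The fibres above the at most q fixed points partition a set of q * q^(r-1)
elements and have at most q^(r-1) elements each: there is no room for a smaller
one. *)
Lemma card_trace_fibre c : c \in q_fixed -> #|trace_fibre c| = (q ^ (r - 1))%N.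
Proof.
move=> c_fix; set b := (q ^ (r - 1))%N.
have sum_fibres : (\sum_(c in q_fixed) #|trace_fibre c| = q ^ r)%N.
  rewrite -cardF -[RHS]sum1_card.
  rewrite [RHS](partition_big (fun a => trace_poly.[a]) (mem q_fixed)).
    by apply: eq_bigr => d _; rewrite -sum1_card; apply: eq_bigl => a; rewrite inE.
  by move=> a _; rewrite /= inE expr_q_trace.
apply/eqP; rewrite eqn_leq card_trace_fibre_le /=.
rewrite (bigD1 c) //= (nt_q_exp _ r_gt1) in sum_fibres.
have others : (\sum_(d in q_fixed | d != c) #|trace_fibre d|
    <= (#|q_fixed|).-1 * b)%N.
  rewrite (cardD1 c) c_fix /= -sum_nat_const.
  rewrite [X in (_ <= X)%N](eq_bigl (fun d => (d \in q_fixed) && (d != c))); last first.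
    by move=> d; rewrite !inE andbC.
  by apply: leq_sum => d _; apply: card_trace_fibre_le.
move: sum_fibres others card_q_fixed_le; rewrite -/b.
have := prime_power_gt1 q_pp; move: (#|q_fixed|) => k q_gt1 sum_eq others le_kq.
have := leq_mul (ltnW q_gt1) (leqnn b); have := leq_mul le_kq (leqnn b).
by case: k others {le_kq} => [|k] /=; lia.
Qed.

(** Counting by the second coordinate meets only fibres of the trace above norms,
which all have the same cardinality. *)
Lemma card_PN : #|PN F q r| = (q ^ (2 * r - 1))%N.
Proof.
have -> : #|PN F q r| = (\sum_(b : F) #|trace_fibre (b ^+ e)|)%N.
  rewrite -sum1_card (partition_big snd xpredT) //=.
  apply: eq_bigr => b _; rewrite -sum1_card.
  rewrite (reindex (fun a => (a, b))) /=.
    by apply: eq_bigl => a; rewrite mem_PN inE eqxx andbT.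
  by exists fst => [a //|[a b'] /=]; rewrite inE => /andP[_ /eqP /= ->].
rewrite (eq_bigr (fun=> (q ^ (r - 1))%N)) => [|b _]; last first.
  by rewrite card_trace_fibre // inE expr_q_norm.
by rewrite sum_nat_const cardT -cardE cardF -expnD; congr (q ^ _)%N; lia.
Qed.

Lemma card_fibre_le (P : seq (F * F)) a : P =i PN F q r -> (#|Yset P a| <= e)%N.
Proof.
move=> defP; have e_gt0 := nt_e_gt0 q_pp r_gt1.
have size_e : size ('X^e - trace_poly.[a]%:P) = e.+1 by exact: size_XnsubC.
apply: (@card_le_roots ('X^e - trace_poly.[a]%:P));
  rewrite -?size_poly_eq0 ?size_e //.
move=> b; rewrite inE defP mem_PN => /eqP->.
by rewrite rootE !hornerE subrr.
Qed.

End NormTrace.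

(** * Fibres of the first projection *)

Section Fibres.

Variables (F : finFieldType) (P : seq (F * F)).

Lemma sum_card_fibres : \sum_(a <- enum (Xset P)) #|Yset P a| <= size P.
Proof.
rewrite big_enum /= (leq_trans _ (card_size P)) //.
rewrite -[#|P|]sum1_card [X in _ <= X](partition_big fst xpredT) //=.
rewrite big_mkcond /=; apply: leq_sum => a _; case: ifP => // _.
rewrite -sum1_card (reindex_onto (fun b => (a, b)) snd) /=.
  rewrite leq_eqVlt; apply/orP; left; apply/eqP/eq_bigl => b.
  by rewrite inE !eqxx !andbT.
by move=> [a' b] /= /andP[_ /eqP->].
Qed.

Lemma card_fibre_gt0 a : a \in Xset P -> 0 < #|Yset P a|.
Proof.
rewrite inE => /mapP[[a' b] abP /= ->].
by apply/card_gt0P; exists b; rewrite inE.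
Qed.

Lemma card_Xset_gt0 : 0 < size P -> 0 < #|Xset P|.
Proof.
case: P => // ab P' _; apply/card_gt0P; exists ab.1.
by rewrite inE mem_head.
Qed.

End Fibres.

(** * Cost of the evaluation *)

Section Encoding.

Variables (F : finFieldType) (M : nat -> nat) (C : nat) (A : subroutines F).
Hypotheses (hM : multiplication_time M) (hA : implements M C A).

(** The sizes of the evaluations in X and in Y have to be bounded by l one by one
and by c1 l, c2 l in total; the other terms count table operations. *)
Lemma cost_BivariateMPE_le (f : bipoly F) (P : seq (F * F)) l c1 c2 :
    0 < size P -> 0 < l ->
    (forall i, i < size f -> (size (f`_i)%R).-1 + #|Xset P| <= l) ->
    \sum_(i <- iota 0 (size f)) ((size (f`_i)%R).-1 + #|Xset P|) <= c1 * l ->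
    (forall a, a \in Xset P -> size f + #|Yset P a| <= l) ->
    size f * #|Xset P| + size P <= c2 * l ->
  cost (BivariateMPE A f P)
    <= 4 * size P + size f + (2 * size f + 2) * #|Xset P|
       + C * (c1 + c2) * (M l * lg l).
Proof.
move=> P_gt0 l_gt0 rows_le rows_sum cols_le cols_sum.
rewrite /BivariateMPE !cost_bind cost_mapM !cost_tabulate.
rewrite [cost (compute_X P)]/cost [cost (compute_Y P)]/cost /=.
set X := Xset P; set Fs := result (tabulate _ _ _).
have X_gt0 : 0 < #|X| by apply: card_Xset_gt0.
have rows_cost :
    \sum_(i <- iota 0 (size f)) (cost (UnivariateMPE A f`_i%R X)).+1
    <= size f + C * (c1 * (M l * lg l)).
  pose s i := (size (f`_i)%R).-1 + #|X|.
  apply: (@leq_trans (\sum_(i <- iota 0 (size f)) (1 + C * (M (s i) * lg (s i))))).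
    by apply: leq_sum => i _; rewrite add1n ltnS; apply: UnivariateMPE_cost hA _ _.
  rewrite big_split /= sum1_size size_iota leq_add2l -big_distrr leq_mul2l.
  apply/orP; right; apply: (sum_mult_lg hM) => // i.
  by rewrite mem_iota add0n /s => /= /rows_le->; rewrite addn_gt0 X_gt0 orbT.
set G := \sum_(a <- enum X) _.
have cols_cost :
    G <= (2 * size f + 2) * #|X| + C * (c2 * (M l * lg l)).
  pose s a := size f + #|Yset P a|.
  apply: (@leq_trans (\sum_(a <- enum X) (2 * size f + 2 + C * (M (s a) * lg (s a))))).
    rewrite /G big_seq [X in _ <= X]big_seq; apply: leq_sum => a.
    rewrite mem_enum => aX; rewrite cost_mapM.
    rewrite (eq_bigr (fun=> 2)) // sum_nat_const_seq size_iota.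
    set g := result (mapM _ _); have le_g : size (Poly g) <= size f.
      by rewrite (leq_trans (size_Poly _)) // /g result_mapM size_map size_iota.
    have Ya_gt0 : 0 < #|Yset P a| by apply: card_fibre_gt0.
    have le_s : (size (Poly g)).-1 + #|Yset P a| <= s a by rewrite /s; lia.
    have M_le := leq_mul (leqnn C) (leq_mult_lg hM (ltn_addl _ Ya_gt0) le_s).
    have := leq_trans (UnivariateMPE_cost hA (Poly g) (Yset P a)) M_le.
    move: (cost (UnivariateMPE _ _ _)) (C * _) => x y le_xy.
    have lin t : t * 2 + (1 + x) < 2 * t + 2 + y by lia.
    exact: lin.
  rewrite big_split /= sum_nat_const_seq -cardE mulnC leq_add2l -big_distrr.
  rewrite leq_mul2l; apply/orP; right; apply: (sum_mult_lg hM) => // [a|].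
    rewrite mem_enum => aX; rewrite cols_le // andbT /s.
    by rewrite addn_gt0 card_fibre_gt0 ?orbT.
  apply: leq_trans cols_sum; rewrite big_split /= sum_nat_const_seq -cardE.
  by rewrite mulnC leq_add2l sum_card_fibres.
rewrite -[\sum_(a <- P) _]/(\sum_(a <- P) 2) sum_nat_const_seq.
have lin p t x R S B : R <= t + C * (c1 * B) -> S <= (2 * t + 2) * x + C * (c2 * B) ->
  p + (p + (R + (S + p * 2))) <= 4 * p + t + (2 * t + 2) * x + C * (c1 + c2) * B.
  by lia.
exact: lin rows_cost cols_cost.
Qed.

End Encoding.

(** * Encoding *)

Section MessagePoly.

Variables (F : finFieldType) (q r m : nat) (c : nat * nat -> F).
Local Notation e := (nt_e q r).

Lemma mem_rr_basis ij : ij \in rr_basis q r m ->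
  ij.2 < e /\ e * ij.1 + q ^ r.-1 * ij.2 <= m.
Proof.
rewrite mem_filter => /andP[-> /allpairsP[[i j] [_ /= ltj ->]]] /=.
by move: ltj; rewrite mem_iota.
Qed.

Lemma size_message_poly : size (message_poly q r m c) <= e.
Proof.
rewrite /message_poly (leq_trans (size_sum _ _ _)) // big_seq.
apply: (big_ind (fun k => k <= e)) => [//|x y hx hy|ij /mem_rr_basis[lt_e _]].
  by rewrite geq_max hx.
rewrite mul_polyC (leq_trans (size_scale_leq _ _)) //.
by rewrite size_polyXn.
Qed.

(** The exponents satisfy e i <= m: summed over the at most e coefficients, the
degrees in X do not exceed m. *)
Lemma size_message_poly_coef j :
  e * (size ((message_poly q r m c)`_j)%R).-1 <= m.
Proof.
have [->|e_gt0] := posnP e; first by rewrite mul0n.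
rewrite mulnC -leq_divRL //; set k := m %/ e.
suff: size ((message_poly q r m c)`_j)%R <= k.+1 by case: (size _).
rewrite /message_poly coef_sum (leq_trans (size_sum _ _ _)) // big_seq.
apply: (big_ind (fun n => n <= k.+1)) => [//|x y hx hy|ij /mem_rr_basis[_ le_m]].
  by rewrite geq_max hx.
rewrite coefCM coefXn; case: (j == ij.2); last by rewrite mulr0 size_poly0.
rewrite mulr1 (leq_trans (size_scale_leq _ _)) // size_polyXn ltnS.
by rewrite leq_divRL // mulnC; apply: leq_trans le_m; apply: leq_addr.
Qed.

End MessagePoly.

Section Codes.

Variable N : nt_code.
Local Notation q := (nt_q N).
Local Notation r := (nt_r N).
Local Notation n := (nt_n N).

Lemma nt_nE : n = q ^ (2 * r - 1).
Proof. exact: card_PN (nt_q_prime_power N) (nt_r_ge2 N) (nt_card_field N). Qed.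

Lemma nt_n_mul : n = q ^ (r - 1) * q ^ r.
Proof. by rewrite nt_nE -expnD; congr (_ ^ _); have := nt_r_ge2 N; lia. Qed.

Lemma nt_n_gt0 : 0 < n.
Proof. by rewrite nt_nE expn_gt0 ltnW ?(prime_power_gt1 (nt_q_prime_power N)). Qed.

Lemma size_nt_points : size (nt_points N) = n.
Proof.
rewrite -(card_uniqP (nt_points_uniq N)); apply: eq_card => ab.
by rewrite (nt_points_curve ab).
Qed.

End Codes.

Lemma encoding_cost_le (M : nat -> nat)
    (A : forall F : finFieldType, subroutines F) C (E : encoding) :
    multiplication_time M -> implements M C (A (nt_field E)) ->
  encoding_cost A E
    <= (12 + 5 * C) * (M (nt_m E + nt_n E) * lg (nt_m E + nt_n E)).
Proof.
move=> hM hA; set l := nt_m E + nt_n E.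
have q_pp := nt_q_prime_power E; have r_gt1 := nt_r_ge2 E.
have b_gt1 := nt_root_exp_gt1 q_pp r_gt1.
have e_gt0 := nt_e_gt0 q_pp r_gt1; have e_lt := nt_e_lt q_pp r_gt1.
have e_le := nt_e_le q_pp r_gt1; have def_n := nt_n_mul E.
have n_gt0 := nt_n_gt0 E; have l_gt0 : 0 < l by rewrite addn_gt0 n_gt0 orbT.
have le_nl : nt_n E <= l by apply: leq_addl.
set Q := nt_q E ^ nt_r E in e_lt def_n; set b := _ ^ (_ - 1) in b_gt1 e_le def_n.
set e := nt_e _ _ in e_gt0 e_lt e_le.
rewrite /encoding_cost; set f := message_poly _ _ _ _.
set P := nt_points E.
have size_f : size f <= e by apply: size_message_poly.
have size_P : size P = nt_n E by apply: size_nt_points.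
have X_le : #|Xset P| <= Q by rewrite /Q -nt_card_field max_card.
have Y_le a : #|Yset P a| <= Q by rewrite /Q -nt_card_field max_card.
have deg_f i : e * (size (f`_i)%R).-1 <= nt_m E by apply: size_message_poly_coef.
(* The row sizes add up to at most m + eQ, the column sizes to at most eQ + n. *)
have eQ_le : e * Q <= 2 * nt_n E by rewrite def_n mulnA leq_mul2r e_le orbT.
have Q2_le : 2 * Q <= nt_n E by rewrite def_n leq_mul2r b_gt1 orbT.
have B_ge : l <= M l * lg l.
  by rewrite (leq_trans (mult_ge_id hM l_gt0)) // leq_pmulr ?lg_gt0.
have X_mul : size f * #|Xset P| <= e * Q by apply: leq_mul.
apply: leq_trans (cost_BivariateMPE_le hM hA _ l_gt0 _ (c1 := 2) _ _ (c2 := 3) _) _.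
- by rewrite size_P.
- move=> i _; have := deg_f i; nia.
- apply: (@leq_trans (e * (nt_m E %/ e + Q))); last first.
    by rewrite mulnDr; have := leq_divM (nt_m E) e; lia.
  apply: (@leq_trans (\sum_(i <- iota 0 (size f)) (nt_m E %/ e + Q))).
    by apply: leq_sum => i _; rewrite leq_add // leq_divRL // mulnC.
  by rewrite sum_nat_const_seq size_iota leq_mul2r size_f orbT.
- by move=> a _; have := Y_le a; lia.
- by lia.
by rewrite size_P mulnDl; lia.
Qed.

(** * Balanced partition trees *)

Section Trees.

Variable F : finFieldType.

Lemma card_root_set_gt0 (T : ptree F) : 0 < #|root_set T|.
Proof.
elim: T => [a|l l_gt0 r _] /=; first by rewrite cards1.
by apply: leq_trans l_gt0 (subset_leq_card (subsetUl _ _)).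
Qed.

Lemma card_root_node (l r : ptree F) : balanced (Node l r) ->
  #|root_set (Node l r)| = #|root_set l| + #|root_set r|.
Proof.
move=> /and5P[/disjoint_setI0 dis _ _ _ _].
by rewrite -cardsUI dis cards0 addn0.
Qed.

Lemma root_in_nodes (T : ptree F) : root_set T \in nodes T.
Proof. by case: T => [a|l r]; rewrite inE eqxx. Qed.

(** From a + b <= 2^k follows 2a - 1 <= 2^k, hence a <= 2^(k-1) by parity: an
imbalance of 1 does not cost a level. *)
Lemma up_log_child a b : 0 < a -> 0 < b -> a <= b.+1 ->
  (up_log 2 a).+1 <= up_log 2 (a + b).
Proof.
move=> a_gt0 b_gt0 le_ab; have ab_gt1 : 1 < a + b by lia.
have k_gt0 : 0 < up_log 2 (a + b) by rewrite up_log_gt0.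
have := up_logP (a + b) (isT : 1 < 2).
case: (up_log 2 (a + b)) k_gt0 => // k _ le_exp; rewrite ltnS.
by apply: up_log_min => //; move: le_exp; rewrite expnS; lia.
Qed.

(** The nodes of one level are disjoint subsets of the root, and the number of levels is
logarithmic. *)
Lemma sum_card_nodes (T : ptree F) : balanced T ->
  \sum_(N <- nodes T) #|N| <= #|root_set T| * (up_log 2 #|root_set T|).+1.
Proof.
elim: T => [a _|l IHl r IHr bal]; first by rewrite big_seq1 cards1.
have /and5P[_ le_lr le_rl bal_l bal_r] := bal.
have l_gt0 := card_root_set_gt0 l; have r_gt0 := card_root_set_gt0 r.
rewrite [nodes _]/= big_cons big_cat /= -/(root_set (Node l r)) card_root_node //.
have up_l := up_log_child l_gt0 r_gt0 le_lr.
have up_r := up_log_child r_gt0 l_gt0 le_rl; rewrite addnC in up_r.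
have sum_l := leq_trans (IHl bal_l) (leq_mul (leqnn _) up_l).
have sum_r := leq_trans (IHr bal_r) (leq_mul (leqnn _) up_r).
by rewrite mulnS leq_add2l mulnDl leq_add.
Qed.

Lemma sum_mult_nodes (M : nat -> nat) (T : ptree F) Q :
    multiplication_time M -> balanced T -> #|root_set T| <= Q ->
  \sum_(N <- nodes T) M #|N| <= 2 * (M Q * lg Q).
Proof.
move=> hM bal le_Q; have root_gt0 := card_root_set_gt0 T.
have Q_gt0 : 0 < Q by apply: leq_trans le_Q.
have nodes_bounds : forall N, N \in nodes T -> 0 < #|N| <= Q.
  elim: T le_Q {bal root_gt0} => [a|l IHl r IHr] le_Q N.
    by rewrite inE => /eqP->; rewrite cards1.
  have le_l := leq_trans (subset_leq_card (subsetUl _ (root_set r))) le_Q.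
  have le_r := leq_trans (subset_leq_card (subsetUr (root_set l) _)) le_Q.
  rewrite /= inE mem_cat => /or3P[/eqP->|/IHl|/IHr]; [|exact|exact].
  by rewrite le_Q andbT; apply: card_root_set_gt0 (Node l r).
have le_sum : \sum_(N <- nodes T) #|N| <= Q * (2 * lg Q).
  apply: leq_trans (sum_card_nodes bal) _; rewrite leq_mul //.
  have : up_log 2 #|root_set T| <= lg Q.
    by apply: leq_trans (leq_up_log 2 le_Q) _; apply: leq_maxr.
  by have := lg_gt0 Q; lia.
rewrite -(leq_pmul2r Q_gt0) big_distrl /=.
apply: (@leq_trans (\sum_(N <- nodes T) M Q * #|N|)).
  rewrite big_seq [X in _ <= X]big_seq; apply: leq_sum => N.
  by move=> /nodes_bounds/andP[N_gt0 le_N]; apply: mult_superlinear.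
by rewrite -big_distrr (leq_trans (leq_mul (leqnn _) le_sum)) //=; lia.
Qed.

Lemma size_vanishing (S : {set F}) : size (vanishing S) = #|S|.+1.
Proof. by rewrite /vanishing -big_enum /= size_prod_XsubC cardE. Qed.

End Trees.

(** * Combination of the interpolants *)

Section Combine.

Variables (F : finFieldType) (M : nat -> nat) (C : nat) (A : subroutines F).
Hypotheses (hM : multiplication_time M) (hA : implements M C A).

Definition bisize_le (t s : nat) (f : bipoly F) : Prop :=
  size f <= t /\ forall j, size (f`_j)%R <= s.

Lemma bisize_bipoly_mul (f : bipoly F) (u : {poly F}) t s s' :
    bisize_le t s f -> size u <= s'.+1 ->
  bisize_le t (s + s') (result (bipoly_mul A f u)).
Proof.
move=> [f_le coef_le] u_le; rewrite /bipoly_mul /bind /result /= -/(result _).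
rewrite result_mapM; split=> [|j].
  by rewrite (leq_trans (size_Poly _)) // size_map.
rewrite coef_Poly; have [lt_j|le_j] := ltnP j (size f); last first.
  by rewrite nth_default ?size_poly0 ?size_map.
rewrite (nth_map 0%R) // (PolyMul_result hA) (leq_trans (size_polyMleq _ _)) //.
have lin x y : x <= s -> y <= s'.+1 -> (x + y).-1 <= s + s' by lia.
exact: lin (coef_le j) u_le.
Qed.

Lemma cost_bipoly_mul_le (f : bipoly F) (u : {poly F}) t s :
    bisize_le t s f -> size u <= s.+1 ->
  cost (bipoly_mul A f u) <= t * M s.
Proof.
move=> [f_le coef_le] u_le; rewrite /bipoly_mul cost_bind cost_mapM /= addn0.
apply: (@leq_trans (\sum_(p <- f : seq _) M s)); last first.
  by rewrite sum_nat_const_seq leq_mul2r f_le orbT.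
rewrite big_seq [X in _ <= X]big_seq; apply: leq_sum => p.
move=> /(nthP 0%R)[j _ <-]; apply: (PolyMul_cost hA); last by lia.
exact: leq_trans (leq_pred _) (coef_le j).
Qed.

Lemma bisize_bipoly_add (f g : bipoly F) t s :
    bisize_le t s f -> bisize_le t s g ->
  bisize_le t s (result (bipoly_add f g)).
Proof.
move=> [f_le fc_le] [g_le gc_le]; rewrite /bipoly_add /bind /result /= -/(result _).
rewrite result_mapM; split=> [|j].
  by rewrite (leq_trans (size_Poly _)) // size_map size_iota geq_max f_le.
rewrite coef_Poly; set k := maxn _ _; have [lt_j|le_j] := ltnP j k; last first.
  by rewrite nth_default ?size_poly0 ?size_map ?size_iota.
rewrite (nth_map 0) ?size_iota // nth_iota //= add0n.
by rewrite (leq_trans (size_polyD _ _)) // geq_max fc_le gc_le.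
Qed.

Lemma cost_bipoly_add_le (f g : bipoly F) t s :
    bisize_le t s f -> bisize_le t s g ->
  cost (bipoly_add f g) <= t * s.
Proof.
move=> [f_le fc_le] [g_le gc_le]; rewrite /bipoly_add cost_bind cost_mapM /= addn0.
set k := maxn _ _.
apply: (@leq_trans (\sum_(j <- iota 0 k) s)); last first.
  by rewrite sum_nat_const_seq size_iota leq_mul2r geq_max f_le g_le orbT.
by apply: leq_sum => j _; rewrite /cost /= geq_max fc_le gc_le.
Qed.

(** The sizes and the cost are proved together, since the cost at a node depends
on the sizes of the polynomials returned by its children.  At a node with s
leaves below it, the two products take at most t M(s) each; the addition, the
tables and the lookups take at most 4t M(s), as s <= M(s) and 2 <= s. *)
Lemma Combine_le (T : ptree F) (V : table F {poly F})
    (U : table {set F} {poly F}) t :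
    0 < t -> (forall a, size (V a) <= t) ->
    (forall N, N \in nodes T -> U N = vanishing N) -> balanced T ->
  bisize_le t #|root_set T| (result (Combine A T V U)) /\
  cost (Combine A T V U) <= \sum_(N <- nodes T) 6 * t * M #|N|.
Proof.
move=> t_gt0; elim: T V => [a V V_le _ _|l IHl r IHr V V_le U_nodes bal].
  split; last first.
    by rewrite big_seq1 cards1 /cost /=; have := mult_pos hM; nia.
  rewrite /= /bind /result /=; split=> [|j]; first by rewrite size_map_polyC.
  rewrite coef_map /= cards1; exact: size_polyC_leq1.
have /and5P[_ _ _ bal_l bal_r] := bal.
have Ul : U (root_set l) = vanishing (root_set l).
  by apply: U_nodes; rewrite inE mem_cat root_in_nodes orbT.
have Ur : U (root_set r) = vanishing (root_set r).
  by apply: U_nodes; rewrite inE mem_cat root_in_nodes !orbT.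
have U_l : (forall N, N \in nodes l -> U N = vanishing N).
  by move=> N N_l; apply: U_nodes; rewrite inE mem_cat N_l orbT.
have U_r : (forall N, N \in nodes r -> U N = vanishing N).
  by move=> N N_r; apply: U_nodes; rewrite inE mem_cat N_r !orbT.
pose restr S := tabulate 0%R (get V) (enum (S : {set F})).
have restr_le S a : size (result (restr S) a) <= t.
  by rewrite result_tabulate; case: ifP => _; rewrite ?size_poly0 ?V_le.
have [fl_le cost_l] := IHl _ (restr_le (root_set l)) U_l bal_l.
have [fr_le cost_r] := IHr _ (restr_le (root_set r)) U_r bal_r.
rewrite -/(nodes _) big_cons big_cat card_root_node //.
have cost_restr S : cost (restr S) = 2 * #|S|.
  rewrite cost_tabulate (eq_bigr (fun=> 2)) // sum_nat_const_seq -cardE.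
  exact: mulnC.
set fl := result (Combine A l _ U) in fl_le.
set fr := result (Combine A r _ U) in fr_le.
set sl := #|root_set l| in fl_le *; set sr := #|root_set r| in fr_le *.
have ul_le : size (U (root_set l)) <= sl.+1 by rewrite Ul size_vanishing.
have ur_le : size (U (root_set r)) <= sr.+1 by rewrite Ur size_vanishing.
have gl_le := bisize_bipoly_mul fl_le ur_le.
have gr_le := bisize_bipoly_mul fr_le ul_le; rewrite addnC in gr_le.
split; first exact: bisize_bipoly_add gl_le gr_le.
have widen f k k' : k <= k' -> bisize_le t k f -> bisize_le t k' f.
  by move=> le_k [f_le fc_le]; split=> // j; apply: leq_trans le_k.
have cost_gl : cost (bipoly_mul A fl (U (root_set r))) <= t * M (sl + sr).
  by apply: cost_bipoly_mul_le (widen _ _ _ (leq_addr _ _) fl_le) _; lia.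
have cost_gr : cost (bipoly_mul A fr (U (root_set l))) <= t * M (sl + sr).
  by apply: cost_bipoly_mul_le (widen _ _ _ (leq_addl _ _) fr_le) _; lia.
have cost_add := cost_bipoly_add_le gl_le gr_le.
have l_gt0 : 0 < sl := card_root_set_gt0 l.
have r_gt0 : 0 < sr := card_root_set_gt0 r.
have M_ge : sl + sr <= M (sl + sr) by apply: mult_ge_id => //; lia.
have tM_ge := leq_mul (leqnn t) M_ge.
have t_ge := leq_mul t_gt0 (leqnn (sl + sr)).
have -> : cost (Combine A (Node l r) V U) =
  cost (restr (root_set l)) + (cost (Combine A l (result (restr (root_set l))) U) +
  (cost (restr (root_set r)) + (cost (Combine A r (result (restr (root_set r))) U) +
  (1 + (1 + (cost (bipoly_mul A fl (U (root_set r))) +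
  (cost (bipoly_mul A fr (U (root_set l))) + cost (bipoly_add
    (result (bipoly_mul A fl (U (root_set r))))
    (result (bipoly_mul A fr (U (root_set l)))))))))))) by [].
rewrite !cost_restr.
have lin c1 c2 c3 c4 c5 S1 S2 : c1 <= S1 -> c2 <= S2 -> c3 <= t * M (sl + sr) ->
    c4 <= t * M (sl + sr) -> c5 <= t * (sl + sr) ->
  2 * sl + (c1 + (2 * sr + (c2 + (1 + (1 + (c3 + (c4 + c5)))))))
    <= 6 * t * M (sl + sr) + (S1 + S2) by lia.
exact: lin.
Qed.

End Combine.

(** * Unencoding *)

Section Unencoding.

Variables (F : finFieldType) (M : nat -> nat) (C : nat) (A : subroutines F).
Hypotheses (hM : multiplication_time M) (hA : implements M C A).


(** Here b and Q stand for q^(r-1) and q^r; what is used of the curve is that no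
fibre has more than t <= 2b points. *)
Lemma cost_BivariateInterp_le (P : seq (F * F)) (V : table (F * F)%type F) t Q b K :
    0 < size P -> size P <= b * Q -> #|F| <= Q ->
    0 < t -> t <= 2 * b -> 0 < b -> (forall a, #|Yset P a| <= t) ->
    M (2 * Q) * lg (2 * Q) <= K * (b * (M Q * lg Q)) ->
  cost (BivariateInterp A P V) <= (50 + C * (2 + K)) * (b * (M Q * lg Q)).
Proof.
move=> P_gt0 P_le F_le t_gt0 t_le b_gt0 Y_le K_le; set B := b * (M Q * lg Q).
set X := Xset P.
have X_gt0 : 0 < #|X| by apply: card_Xset_gt0.
have X_le : #|X| <= Q by apply: leq_trans (max_card _) F_le.
have Q_gt0 : 0 < Q by apply: leq_trans X_le.
have MQ_ge : Q * lg Q <= M Q * lg Q by rewrite leq_mul2r mult_ge_id ?orbT.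
have B_ge1 : M Q * lg Q <= B by rewrite leq_pmull.
have B_ge2 : b * Q <= B.
  by rewrite leq_mul2l (leq_trans _ MQ_ge) ?orbT // leq_pmulr ?lg_gt0.
have Q_le : Q <= b * Q by rewrite leq_pmull.
have X_neq0 : X != set0 by rewrite -card_gt0.
have T_part := PartitionTree_result hA X_neq0; have [T_root T_bal] := T_part.
pose T := PartitionTree A X; pose U := result (TreeVanish A T).
rewrite /BivariateInterp !cost_bind -[result (compute_X P)]/X.
rewrite -[result (compute_tree A X)]/T -[result (get _ X)]/(U X) -/U.
set fhat := tabulate _ _ _; set W := tabulate _ _ (enum X).
have U_nodes N : N \in nodes T -> U N = vanishing N.
  exact: (TreeVanish_result hA T_part).
have size_UX : size (U X) = #|X|.+1.
  by rewrite U_nodes ?size_vanishing // -T_root root_in_nodes.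
have cost_fhat : cost fhat <= 2 * #|X| + 2 * size P + C * B.
  rewrite cost_tabulate; pose nY a := #|Yset P a|.
  apply: (@leq_trans (\sum_(a <- enum X) (2 + 2 * nY a + C * (M (nY a) * lg (nY a))))).
    apply: leq_sum => a _; rewrite !cost_bind cost_tabulate.
    rewrite (eq_bigr (fun=> 2)) // sum_nat_const_seq -cardE.
    have := UnivariateInterp_cost hA (Yset P a)
      (result (tabulate 0%R (fun b => get V (a, b)) (enum (Yset P a)))).
    have lin c y k : c <= k -> (1 + (y * 2 + c)).+1 <= 2 + 2 * y + k by lia.
    exact: lin.
  rewrite big_split [\sum_(_ <- _) (_ + _)]big_split /= sum_nat_const_seq.
  rewrite -cardE -!big_distrr /= [#|X| * 2]mulnC.
  have y_sum : \sum_(a <- enum X) nY a <= size P := sum_card_fibres P.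
  apply: leq_add; first by apply: leq_add => //; apply: leq_mul.
  rewrite leq_mul2l; apply/orP; right; apply: (sum_mult_lg hM) => // [a|].
    rewrite mem_enum => aX; rewrite card_fibre_gt0 //=.
    by apply: leq_trans (max_card _) F_le.
  exact: leq_trans y_sum P_le.
have fhat_le a : size (result fhat a) <= t.
  rewrite result_tabulate; case: ifP => _; last by rewrite size_poly0.
  exact: leq_trans (UnivariateInterp_size hA _ _) (Y_le a).
have cost_T : cost (compute_tree A X) <= 2 * (Q * lg Q).
  apply: leq_trans (sum_card_nodes T_bal) _; rewrite T_root.
  have le_up : up_log 2 #|X| <= lg Q.
    by apply: leq_trans (leq_up_log 2 X_le) _; apply: leq_maxr.
  apply: leq_trans (leq_mul X_le (_ : _ <= 2 * lg Q)) _; last by lia.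
  by have := lg_gt0 Q; lia.
have cost_U : cost (TreeVanish A T) <= C * B.
  apply: leq_trans (TreeVanish_cost hA T_part) _; rewrite leq_mul2l.
  by rewrite (leq_trans (leq_mult_lg hM X_gt0 X_le)) ?orbT.
have cost_h : cost (poly_deriv (U X)) <= 4 * Q.
  by rewrite /cost /= size_UX; lia.
set h := result (poly_deriv (U X)).
(* The derivative has degree less than |X|, so this evaluation has size at
   most 2Q. *)
have cost_R : cost (UnivariateMPE A h X) <= C * (K * B).
  apply: leq_trans (UnivariateMPE_cost hA h X) _; rewrite leq_mul2l.
  apply/orP; right; apply: leq_trans K_le.
  apply: (leq_mult_lg hM); first by rewrite addn_gt0 X_gt0 orbT.
  have UX_neq0 : U X != 0%R by rewrite -size_poly_eq0 size_UX.
  have := lt_size_deriv UX_neq0; rewrite size_UX -/(result (poly_deriv (U X))) -/h.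
  have lin z x : z < x.+1 -> x <= Q -> z.-1 + x <= 2 * Q by lia.
  by move/lin; apply.
have cost_W : cost W <= (3 + t) * #|X|.
  rewrite cost_tabulate mulnC cardE -sum_nat_const_seq.
  apply: leq_sum => a _; rewrite !cost_bind cost_mapM.
  rewrite (eq_bigr (fun=> 1)) // sum_nat_const_seq /=.
  have lin z : z <= t -> (1 + (1 + (z * 1 + 0))).+1 <= 3 + t by lia.
  exact: lin (fhat_le a).
have W_le a : size (result W a) <= t.
  rewrite result_tabulate; case: ifP => _; last by rewrite size_poly0.
  apply: leq_trans (size_Poly _) _.
  by rewrite result_mapM size_map; apply: fhat_le.
have [_ cost_C] := Combine_le hM hA t_gt0 W_le U_nodes T_bal.
have sum_M : \sum_(N <- nodes T) M #|N| <= 2 * (M Q * lg Q).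
  by apply: sum_mult_nodes; rewrite ?T_root.
rewrite -big_distrr in cost_C.
have {}cost_C := leq_trans cost_C (leq_mul (leqnn _) sum_M).
have tMQ_le : t * (M Q * lg Q) <= 2 * B.
  by rewrite [2 * B]mulnA leq_mul2r t_le orbT.
have tX_le : (3 + t) * #|X| <= 3 * Q + 2 * (b * Q).
  have := leq_mul t_le X_le; rewrite mulnDl; lia.
have lin cf cT cU ch cR cW cC :
    cf <= 2 * #|X| + 2 * size P + C * B -> cT <= 2 * (Q * lg Q) ->
    cU <= C * B -> ch <= 4 * Q -> cR <= C * (K * B) -> cW <= (3 + t) * #|X| ->
    cC <= 6 * t * (2 * (M Q * lg Q)) ->
  size P + (size P + (cf + (cT + (cU + (1 + (ch + (cR + (cW + cC))))))))
    <= (50 + C * (2 + K)) * B.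
  move=> *; rewrite mulnDl; lia.
exact: lin.
Qed.

End Unencoding.

Lemma unencoding_cost_le (M : nat -> nat)
    (A : forall F : finFieldType, subroutines F) C K (D : unencoding) :
  let b := nt_q D ^ (nt_r D - 1) in let Q := nt_q D ^ nt_r D in
    multiplication_time M -> implements M C (A (nt_field D)) ->
    M (2 * Q) * lg (2 * Q) <= K * (b * (M Q * lg Q)) ->
  unencoding_cost A D <= (51 + C * (2 + K)) * (b * (M Q * lg Q)).
Proof.
move=> b Q hM hA K_le.
have q_pp := nt_q_prime_power D; have r_gt1 := nt_r_ge2 D.
have b_gt1 : 1 < b := nt_root_exp_gt1 q_pp r_gt1.
have e_gt0 := nt_e_gt0 q_pp r_gt1; have e_le := nt_e_le q_pp r_gt1.
have def_n : nt_n D = b * Q := nt_n_mul D; have n_gt0 := nt_n_gt0 D.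
have size_P : size (nt_points D) = nt_n D := size_nt_points D.
have Q_gt0 : 0 < Q by move: n_gt0; rewrite def_n muln_gt0 => /andP[].
rewrite /unencoding_cost /SemiGridUnencode cost_bind cost_tabulate.
rewrite (eq_bigr (fun=> 1)) // sum_nat_const_seq muln1.
set V := result _.
have cost_I : cost (BivariateInterp (A (nt_field D)) (nt_points D) V)
    <= (50 + C * (2 + K)) * (b * (M Q * lg Q)).
  apply: (cost_BivariateInterp_le hM hA V _ _ _ e_gt0) => //; rewrite ?size_P ?def_n //.
  - by rewrite -def_n.
  - by rewrite nt_card_field.
  - exact: ltnW.
  - by move=> a; apply: card_fibre_le => //; apply: nt_points_curve.
have P_le : b * Q <= b * (M Q * lg Q).
  rewrite leq_mul2l (leq_trans (mult_ge_id hM Q_gt0)) ?orbT //.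
  by rewrite leq_pmulr ?lg_gt0.
by rewrite size_P def_n (leq_trans (leq_add P_le cost_I)).
Qed.

Theorem corollaryV7 (M : nat -> nat)
    (A : forall F : finFieldType, subroutines F)
    (hM : multiplication_time M)
    (hA : exists C : nat, forall F : finFieldType, implements M C (A F)) :
  let enc_bound (E : encoding) :=
    M (nt_m E + nt_n E) * lg (nt_m E + nt_n E) in
  let unenc_bound (D : unencoding) :=
    nt_q D ^ (nt_r D - 1) * (M (nt_q D ^ nt_r D) * lg (nt_q D ^ nt_r D)) in
  [/\ forall N : nt_code, nt_n N = nt_q N ^ (2 * nt_r N - 1),
      bigO enc_bound (encoding_cost A),
      forall f, bigO enc_bound f -> softO (fun E : encoding => nt_n E) f,
      bigO unenc_bound (unencoding_cost A)
    & forall f, bigO unenc_bound f -> softO (fun D : unencoding => nt_n D) f].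
Proof.
have [C hC] := hA; move=> enc_bound unenc_bound.
have [C3 M_lg3] := mult_lg_quasilinear hM.
have [K M_double] := mult_lg_double hM.
split.
- exact: nt_nE.
- exists (12 + 5 * C) => E; exact: encoding_cost_le.
- move=> f [c f_le]; exists 3, (c * (C3 * 16)) => E.
  apply: leq_trans (f_le E) _; rewrite -mulnA leq_mul2l; apply/orP; right.
  have n_gt0 := nt_n_gt0 E; have m_lt : nt_m E < nt_n E := nt_m_lt E.
  have l_le : nt_m E + nt_n E <= 2 * nt_n E by lia.
  apply: leq_trans (M_lg3 _ _) _; first by rewrite addn_gt0 n_gt0 orbT.
  rewrite -mulnA leq_mul2l; apply/orP; right.
  have lg_le : lg (nt_m E + nt_n E) ^ 3 <= 8 * lg (nt_n E) ^ 3.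
    rewrite -(expnMn 2 _ 3) leq_exp2r //.
    exact: leq_trans (leq_lg l_le) (lg_double _).
  by have := leq_mul l_le lg_le; lia.
- exists (51 + C * (2 + K)) => D; apply: unencoding_cost_le => //.
  have q_pp := nt_q_prime_power D; have r_gt1 := nt_r_ge2 D.
  apply: M_double (nt_q_exp_le q_pp r_gt1).
    exact: ltnW (nt_root_exp_gt1 q_pp r_gt1).
  by rewrite expn_gt0 ltnW ?prime_power_gt1.
move=> f [c f_le]; exists 3, (c * C3) => D.
apply: leq_trans (f_le D) _; rewrite -mulnA leq_mul2l; apply/orP; right.
have def_n := nt_n_mul D; have n_gt0 := nt_n_gt0 D.
rewrite /unenc_bound; set b := _ ^ (_ - 1) in def_n *; set Q := _ ^ _ in def_n *.
have := n_gt0; rewrite def_n muln_gt0 => /andP[b_gt0 Q_gt0].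
apply: leq_trans (leq_mul (leqnn b) (M_lg3 _ Q_gt0)) _.
have lg_le : lg Q ^ 3 <= lg (b * Q) ^ 3 by rewrite leq_exp2r // leq_lg // leq_pmull.
by have := leq_mul (leqnn (C3 * (b * Q))) lg_le; lia.
Qed.
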